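(* Let $K$ be a field of characteristic different from $2$, let $A$ be a finite-dimensional Malcev algebra over $K$, let $k'\ge 1$ be an integer, and let $B$ be a $J_{k'}$-nil ideal of $A$. Then the following conditions are equivalent: (i) $B$ is right nilpotent; (ii) $B$ is nilpotent; (iii) $B$ is strongly nilpotent.
   Context: For a (not necessarily associative) $K$-algebra $A$, the Jacobian is $J(x,y,z)=(xy)z+(yz)x+(zx)y$. $A$ is a Malcev algebra if $x^2=0$ for all $x\in A$ and $J(x,y,xz)=J(x,y,z)x$ for all $x,y,z\in A$. For an ideal $B$ of $A$, $J(B,A,A)$ is the subspace of $A$ spanned by all $J(b,x,y)$ with $b\in B$, $x,y\in A$ (it is an ideal of $A$). A right product of length $m$ is $s_ms_{m-1}\cdots s_1:=((\cdots((s_ms_{m-1})s_{m-2})\cdots)s_2)s_1$. For a subspace $D$ of $A$ and an integer $k\ge1$, $D_{(A,k)}$ is the subspace spanned by all right products $d\,a_k\cdots a_2a_1$ with $d\in D$ and $a_1,\dots,a_k\in A$. A nonzero ideal $B$ of $A$ is called $J_k$-nil (for an integer $k\ge 1$) if $J(B,A,A)_{(A,k)}=\{0\}$. For an ideal $B$ of $A$ and an integer $n\ge1$: $B^n$ is the subspace spanned by all right products of length $n$ all of whose factors lie in $B$; $B^{\{n\}}$ is the subspace spanned by all products, bracketed in any way, of $n$ elements of $B$; $B^{\langle n\rangle}$ is the set of sums of products (bracketed in any way) of elements of $A$ with at least $n$ factors in $B$. The ideal $B$ is right nilpotent (respectively nilpotent, strongly nilpotent) if there is an integer $n\ge1$ with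 $B^n=\{0\}$ (respectively $B^{\{n\}}=\{0\}$, $B^{\langle n\rangle}=\{0\}$). *)

(* Defs.v *)
From mathcomp Require Import all_boot all_order all_algebra.
From mathcomp Require Import classical_sets.

Set Implicit Arguments.
Unset Strict Implicit.
Unset Printing Implicit Defensive.

Import GRing.Theory.

Local Open Scope classical_set_scope.
Local Open Scope ring_scope.

(* Finite bracketed words over T, i.e. binary trees with leaves in T. *)
Inductive bracketing (T : Type) : Type :=
| Factor of T
| Product of bracketing T & bracketing T.

Fixpoint factors (T : Type) (t : bracketing T) : seq T :=
  match t with
  | Factor x => [:: x]
  | Product t1 t2 => factors t1 ++ factors t2
  end.

(* A finite-dimensional, not necessarily associative K-algebra is a           *)
(* finite-dimensional vector space A with a bilinear product mul.             *)
Section NonassociativeAlgebra.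

Variables (K : fieldType) (A : vectType K) (mul : {bilinear A -> A -> A}).

Local Notation "x ** y" := (mul x y) (at level 40, left associativity).

Definition jacobian (x y z : A) : A :=
  (x ** y) ** z + (y ** z) ** x + (z ** x) ** y.

Definition malcev : Prop :=
  (forall x : A, x ** x = 0) /\
  (forall x y z : A, jacobian x y (x ** z) = jacobian x y z ** x).

Definition ideal (B : {vspace A}) : Prop :=
  forall a b : A, b \in B -> a ** b \in B /\ b ** a \in B.

(* Linear span of an arbitrary, possibly infinite, set of vectors. *)
Definition lspan (P : set A) : set A :=
  [set v | exists2 s : seq A, (forall x, x \in s -> P x) & v \in <<s>>%VS].

Definition finite_sums (P : set A) : set A :=
  [set v | exists2 s : seq A, (forall x, x \in s -> P x) & v = \sum_(x <- s) x].

(* rprod x [:: y1; ...; yr] = ((x y1) ... ) yr is a right product of length   *)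
(* r + 1.                                                                     *)
Definition rprod (x : A) (s : seq A) : A := foldl (fun u v => u ** v) x s.

Fixpoint bprod (t : bracketing A) : A :=
  match t with
  | Factor x => x
  | Product t1 t2 => bprod t1 ** bprod t2
  end.

(* J(B, A, A) *)
Definition jacobian_ideal (B : {vspace A}) : set A :=
  lspan [set v | exists b x y : A, b \in B /\ v = jacobian b x y].

(* D_(A, k) *)
Definition right_mult (D : set A) (k : nat) : set A :=
  lspan [set v | exists (d : A) (s : seq A),
                   [/\ D d, size s = k & v = rprod d s]].

Definition jacobian_nil (k : nat) (B : {vspace A}) : Prop :=
  [/\ ideal B, B <> 0%VS & right_mult (jacobian_ideal B) k = [set 0]].

(* B^n *)
Definition right_power (B : {vspace A}) (n : nat) : set A :=
  lspan [set v | exists (x : A) (s : seq A),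
                   [/\ size (x :: s) = n, all [in B] (x :: s) & v = rprod x s]].

(* B^{n} *)
Definition full_power (B : {vspace A}) (n : nat) : set A :=
  lspan [set v | exists t : bracketing A,
                   [/\ size (factors t) = n, all [in B] (factors t)
                     & v = bprod t]].

(* B^<n> *)
Definition strong_power (B : {vspace A}) (n : nat) : set A :=
  finite_sums [set v | exists t : bracketing A,
                         (n <= count [in B] (factors t))%N /\ v = bprod t].

Definition right_nilpotent (B : {vspace A}) : Prop :=
  exists2 n : nat, (1 <= n)%N & right_power B n = [set 0].

Definition nilpotent (B : {vspace A}) : Prop :=
  exists2 n : nat, (1 <= n)%N & full_power B n = [set 0].

Definition strongly_nilpotent (B : {vspace A}) : Prop :=
  exists2 n : nat, (1 <= n)%N & strong_power B n = [set 0].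

End NonassociativeAlgebra.

(* Main.v *)
(** Let N be the set of all x killed by every right product with k' or more
    further factors. N is an ideal containing J(B, A, A), so modulo N the ideal
    B behaves as in a Lie algebra: a product with n factors in B lies in
    B^n + N, hence in N once B^n = 0. In a product with at least n * 2^k'
    factors in B, following the heavier operand k' times downwards reaches a
    subproduct that still has n factors in B and so lies in N; the k'
    multiplications on the way back up annihilate it. *)

Require Import Defs.
From mathcomp Require Import all_boot all_order all_algebra.
From mathcomp Require Import classical_sets.

Set Implicit Arguments.
Unset Strict Implicit.
Unset Printing Implicit Defensive.

Import GRing.Theory.

Local Open Scope ring_scope.

Section JacobianNilIdeal.

Context (K : fieldType) (A : vectType K) (mul : {bilinear A -> A -> A}).

Local Notation "x ** y" := (mul x y) (at level 40, left associativity).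

(** * Vanishing of spans, and additivity of right products *)

Lemma sub_lspan (P : set A) (v : A) : P v -> lspan P v.
Proof.
by move=> Pv; exists [:: v]; [move=> x; rewrite inE => /eqP->|exact: memv_span1].
Qed.

Lemma lspan_eq0 (P : set A) :
  (forall v, P v -> v = 0) <-> lspan P = [set 0]%classic.
Proof.
split=> [P0|P0 v Pv]; last by have := sub_lspan Pv; rewrite P0.
apply/seteqP; split=> [v [s sP sv]|v -> /=].
  suff: (<<s>> <= 0)%VS by move=> /subvP/(_ _ sv); rewrite memv0 => /eqP.
  by apply/span_subvP => x /sP/P0 ->; exact: mem0v.
by exists [::] => //; exact: mem0v.
Qed.

Lemma finite_sums_eq0 (P : set A) :
  (forall v, P v -> v = 0) <-> finite_sums P = [set 0]%classic.
Proof.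
split=> [P0|P0 v Pv].
  apply/seteqP; split=> [v [s sP ->] /=|v -> /=].
    by apply: big1_seq => x /sP/P0.
  by exists [::]; rewrite ?big_nil.
suff: finite_sums P v by rewrite P0.
by exists [:: v]; rewrite ?big_seq1 // => x; rewrite inE => /eqP->.
Qed.

Lemma rprod0 (s : seq A) : rprod mul 0 s = 0.
Proof. by elim: s => //= a s; rewrite linear0l. Qed.

Lemma rprodD (s : seq A) : {morph (fun x => rprod mul x s) : x y / x + y}.
Proof. by elim: s => //= a s IH x y; rewrite linearDl IH. Qed.

Lemma rprodN (s : seq A) : {morph (fun x => rprod mul x s) : x / - x}.
Proof. by elim: s => //= a s IH x; rewrite linearNl IH. Qed.

Lemma rprod_cat (x : A) (s1 s2 : seq A) :
  rprod mul x (s1 ++ s2) = rprod mul (rprod mul x s1) s2.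
Proof. exact: foldl_cat. Qed.

Lemma bprod_right_comb (x : A) (s : seq A) :
  exists2 t, factors t = x :: s & bprod mul t = rprod mul x s.
Proof.
elim/last_ind: s => [|s a [t tE tP]]; first by exists (Factor x).
exists (Product t (Factor a)); first by rewrite /= tE cats1.
by rewrite /= tP -cats1 rprod_cat.
Qed.

(** * The two easy implications *)

Lemma strongly_nilpotent_nilpotent (B : {vspace A}) :
  strongly_nilpotent mul B -> nilpotent mul B.
Proof.
move=> [n n1 /finite_sums_eq0 Bn]; exists n => //.
apply/lspan_eq0 => v [t [tn tB ->]]; apply: Bn; exists t; split=> //.
by move: tB; rewrite all_count => /eqP->; rewrite tn.
Qed.

Lemma nilpotent_right_nilpotent (B : {vspace A}) :
  nilpotent mul B -> right_nilpotent mul B.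
Proof.
move=> [n n1 /lspan_eq0 Bn]; exists n => //.
apply/lspan_eq0 => v [x [s [sn sB ->]]]; apply: Bn.
by have [t tE tP] := bprod_right_comb x s; exists t; rewrite tE tP.
Qed.

(** * Elements killed by long right products, and the filtration by degree in [B] *)

Definition annihilated (j : nat) (x : A) : Prop :=
  forall s, (j <= size s)%N -> rprod mul x s = 0.

Lemma annihilatedN (j : nat) (x : A) : annihilated j x -> annihilated j (- x).
Proof. by move=> xj s /xj; rewrite rprodN => ->; rewrite oppr0. Qed.

Lemma annihilatedD (j : nat) (x y : A) :
  annihilated j x -> annihilated j y -> annihilated j (x + y).
Proof. by move=> xj yj s js; rewrite rprodD xj ?yj ?addr0. Qed.

Lemma annihilatedW (i j : nat) (x : A) :
  (i <= j)%N -> annihilated i x -> annihilated j x.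
Proof. by move=> ij xi s js; apply: xi; exact: leq_trans js. Qed.

(** The factor [a] uses up one of the [j] factors. At level 0 only the zero vector remains, since
    [s] may be empty. *)
Lemma annihilated_mulr (j : nat) (x a : A) :
  annihilated j x -> annihilated j.-1 (x ** a).
Proof. by move=> xj s js; apply: (xj (a :: s)); case: j js {xj}. Qed.

Lemma right_nilpotent_rprod (B : {vspace A}) :
  right_nilpotent mul B ->
  exists m, forall (x : A) (s : seq A),
    x \in B -> all [in B] s -> (m <= size s)%N -> rprod mul x s = 0.
Proof.
move=> [m m1 /lspan_eq0 Bm]; exists m => x s xB sB ms.
rewrite -(cat_take_drop m.-1 s) rprod_cat (Bm (rprod mul x _)) ?rprod0 //.
exists x, (take m.-1 s); split=> //=.
  by rewrite size_takel ?prednK // (leq_trans (leq_pred m)).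
by rewrite xB; move: sB; rewrite -{1}(cat_take_drop m.-1 s) all_cat => /andP[].
Qed.

Lemma jacobian_nil_annihilated (k : nat) (B : {vspace A}) (b x y : A) :
  jacobian_nil mul k B -> b \in B -> annihilated k (jacobian mul b x y).
Proof.
move=> [_ _ /lspan_eq0 JB] bB s ks.
rewrite -(cat_take_drop k s) rprod_cat (JB (rprod mul _ (take k s))).
  exact: rprod0.
exists (jacobian mul b x y), (take k s); rewrite size_takel //; split=> //.
by apply: sub_lspan; exists b, x, y.
Qed.

(** B^n + N for the ideal N of elements annihilated by k factors, extended by
    A in degree 0 so that the degree counts the factors in B. *)
Inductive lower_central (B : {vspace A}) (k : nat) : nat -> A -> Prop :=
| LowerAny x : lower_central B k 0 x
| LowerIn b : b \in B -> lower_central B k 1 b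
| LowerMul n u b :
    lower_central B k n u -> b \in B -> lower_central B k n.+1 (u ** b)
| LowerAnnihilated n x : annihilated k x -> lower_central B k n x
| LowerAdd n x y :
    lower_central B k n x -> lower_central B k n y ->
    lower_central B k n (x + y)
| LowerOpp n x : lower_central B k n x -> lower_central B k n (- x).

Lemma lower_central_annihilated (B : {vspace A}) (k m n : nat) (x : A) :
  (forall (b : A) (s : seq A),
     b \in B -> all [in B] s -> (m <= size s)%N -> rprod mul b s = 0) ->
  (forall a b : A, b \in B -> a ** b \in B) ->
  lower_central B k n x -> (m < n)%N -> annihilated k x.
Proof.
move=> Bm BA xn mn.
(* The list [s] collects the factors from [B] that the induction peels off through [LowerMul];
   [n + size s] stays constant. *)
suff xN s : all [in B] s -> (m < n + size s)%N -> annihilated k (rprod mul x s).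
  by apply: (xN [::]); rewrite //= addn0.
elim: {mn} xn s => {n x} [x|b bB|n u b _ IH bB|n x xN|n x y _ IHx _ IHy|n x _ IH]
    s sB ms.
(* The element [x] need not lie in [B], so the first factor of [s] is spent on moving it there; the
   strict bound pays for that. *)
- case: s sB ms => //= b s /andP[bB sB] ms t _.
  by rewrite (Bm (x ** b)) ?rprod0 ?BA.
- by move=> t _; rewrite (Bm b s bB sB ms) rprod0.
- by apply: (IH (b :: s)); rewrite /= ?bB // addnS.
- by move=> t kt; rewrite -rprod_cat xN // size_cat (leq_trans kt) ?leq_addl.
- by rewrite rprodD; apply: annihilatedD; [exact: IHx|exact: IHy].
- by rewrite rprodN; apply: annihilatedN; exact: IH.
Qed.

Lemma lower_centralW (B : {vspace A}) (k m n : nat) (x : A) :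
  lower_central B k m x -> (n <= m)%N -> lower_central B k n x.
Proof.
move=> xm; elim: xm n
    => {m x} [x|b bB|m u b _ IH bB|m x xN|m x y _ IHx _ IHy|m x _ IH]
    n nm.
- by move: nm; rewrite leqn0 => /eqP->; exact: LowerAny.
- by case: n nm => [|[|n]] // _; [exact: LowerAny|exact: LowerIn].
- case: n nm => [|n nm]; first by move=> _; exact: LowerAny.
  by apply: LowerMul => //; exact: IH.
- exact: LowerAnnihilated.
- by apply: LowerAdd; [exact: IHx|exact: IHy].
- by apply: LowerOpp; exact: IH.
Qed.

(** * Jacobi identities with a Jacobian as defect *)

Hypothesis mulxx : forall x : A, x ** x = 0.

Lemma mul_anticomm (x y : A) : x ** y = - (y ** x).
Proof.
apply/eqP; rewrite -addr_eq0; apply/eqP.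
by have := mulxx (x + y); rewrite linearDl !linearDr !mulxx add0r addr0.
Qed.

Lemma jacobian_rot (x y z : A) : jacobian mul x y z = jacobian mul y z x.
Proof. by rewrite /jacobian -addrA addrC. Qed.

(** Up to the Jacobian, right multiplication by [v ** w] is a commutator of right multiplications,
    as in a Lie algebra. *)
Lemma mulr_jacobian (u v w : A) :
  u ** (v ** w) = - jacobian mul v w u + ((u ** v) ** w - (u ** w) ** v).
Proof.
rewrite /jacobian (mul_anticomm u (v ** w)) (mul_anticomm u w) linearNl opprK.
by rewrite [_ ** w + _]addrC -addrA opprD subrK.
Qed.

(** Up to the Jacobian, right multiplication by [w] is a derivation. *)
Lemma mull_jacobian (u v w : A) :
  (u ** v) ** w = jacobian mul v w u + (u ** (v ** w) + (u ** w) ** v).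
Proof. by rewrite mulr_jacobian addrA addrA addrN add0r subrK. Qed.

Lemma annihilated_mull (j : nat) (x a : A) :
  annihilated j x -> annihilated j.-1 (a ** x).
Proof.
by move=> xj; rewrite mul_anticomm; apply: annihilatedN; exact: annihilated_mulr.
Qed.

(** * Multiplicativity of the filtration, and the remaining implication *)

Section Filtration.

Context (B : {vspace A}) (k : nat).
Hypothesis BnilJ : jacobian_nil mul k B.

Lemma lower_central_mulA (n : nat) (u a : A) :
  lower_central B k n u -> lower_central B k n (u ** a).
Proof.
have [BI _ _] := BnilJ.
elim=> {n u} [x|b bB|n u b un IH bB|n x xN|n x y _ IHx _ IHy|n x _ IH].
- exact: LowerAny.
- by apply: LowerIn; have [] := BI a b bB.
(* In both [u ** (b ** a)] and [(u ** a) ** b] the last factor lies in [B] and the first keeps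
   degree [n]. *)
- rewrite mull_jacobian; apply: LowerAdd.
    by apply: LowerAnnihilated; exact: jacobian_nil_annihilated BnilJ _.
  apply: LowerAdd; last by apply: LowerMul.
  by apply: LowerMul => //; have [] := BI a b bB.
- apply: LowerAnnihilated; apply: annihilatedW (annihilated_mulr _ xN).
  exact: leq_pred.
- by rewrite linearDl; exact: LowerAdd.
- by rewrite linearNl; exact: LowerOpp.
Qed.

Lemma lower_central_mul (i j : nat) (u v : A) :
  lower_central B k i u -> lower_central B k j v ->
  lower_central B k (i + j) (u ** v).
Proof.
(* Both [i] and [u] are generalized because the term [(u ** b) ** v] calls the induction hypothesis
   on [u ** b], of degree [i.+1]. *)
move=> ui vj; elim: vj i u ui
    => {j v} [v|b bB|j v b _ IH bB|j v vN|j v w _ IHv _ IHw|j v _ IH] i u ui.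
- by rewrite addn0; exact: lower_central_mulA.
- by rewrite addn1; exact: LowerMul.
- rewrite mulr_jacobian; apply: LowerAdd.
    rewrite jacobian_rot; apply/LowerOpp/LowerAnnihilated.
    exact: jacobian_nil_annihilated BnilJ _.
  apply: LowerAdd; first by rewrite addnS; apply: LowerMul => //; exact: IH.
  by apply: LowerOpp; rewrite addnS -addSn; apply: IH; exact: LowerMul.
- apply: LowerAnnihilated; apply: annihilatedW (annihilated_mull _ vN).
  exact: leq_pred.
- by rewrite linearDr; apply: LowerAdd; [exact: IHv|exact: IHw].
- by rewrite linearNr; apply: LowerOpp; exact: IH.
Qed.

Lemma lower_central_bprod (t : bracketing A) :
  lower_central B k (count [in B] (factors t)) (bprod mul t).
Proof.
elim: t => [x|t1 IH1 t2 IH2] /=; last first.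
  by rewrite count_cat; exact: lower_central_mul.
by case: (boolP (x \in B)) => xB; rewrite addn0; [exact: LowerIn|exact: LowerAny].
Qed.

Lemma bprod_annihilated (n d : nat) (t : bracketing A) :
  (0 < n)%N -> (forall x, lower_central B k n x -> annihilated k x) ->
  (n * 2 ^ d <= count [in B] (factors t))%N ->
  annihilated (k - d) (bprod mul t).
Proof.
move=> n0 nN; elim: d t => [|d IH] t.
  rewrite expn0 muln1 subn0 => tn; apply: nN.
  exact: lower_centralW (lower_central_bprod t) tn.
case: t => [x|t1 t2] /=.
  (* A single factor counts at most 1, whereas [n * 2 ^ d.+1] is at least 2. *)
  rewrite addn0 => nx; suff: (1 < 1)%N by [].
  apply: leq_trans (leq_trans nx (leq_b1 _)).
  by rewrite -[2%N]mul1n leq_mul // expnS leq_pmulr // expn_gt0.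
(* The bound is twice [n * 2 ^ d], so one of the operands reaches half of it. *)
rewrite count_cat expnS mulnCA mul2n -addnn subnS => nt.
have [/IH t1N|t1n] := leqP (n * 2 ^ d) (count [in B] (factors t1)).
  exact: annihilated_mulr.
apply: annihilated_mull; apply: IH.
by rewrite -(leq_add2l (n * 2 ^ d)) (leq_trans nt) // leq_add2r ltnW.
Qed.

Lemma right_nilpotent_strongly_nilpotent :
  right_nilpotent mul B -> strongly_nilpotent mul B.
Proof.
have [BI _ _] := BnilJ; move=> /right_nilpotent_rprod[m Bm].
have lowerN x : lower_central B k m.+1 x -> annihilated k x.
  move=> xm; apply: lower_central_annihilated Bm _ xm _ => // a b bB.
  by have [] := BI a b bB.
exists (m.+1 * 2 ^ k)%N; first by rewrite muln_gt0 expn_gt0.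
apply/finite_sums_eq0 => v [t [tn ->]].
(* Here [d] is [k], so the level drops to 0 and the empty list gives the product itself. *)
have /(_ [::]) := bprod_annihilated (ltn0Sn m) lowerN tn.
by rewrite subnn; apply.
Qed.

End Filtration.

End JacobianNilIdeal.

Unset Implicit Arguments.

Theorem mainTheorem2 (K : fieldType) (A : vectType K)
    (mul : {bilinear A -> A -> A}) (k' : nat) (B : {vspace A}) :
  2%N \notin [pchar K] -> malcev mul -> (1 <= k')%N -> jacobian_nil mul k' B ->
  [<-> right_nilpotent mul B; nilpotent mul B; strongly_nilpotent mul B].
Proof.
move=> _ [mulxx _] _ BnilJ.
have strong := right_nilpotent_strongly_nilpotent mulxx BnilJ.
tfae.
- by move=> /strong; exact: strongly_nilpotent_nilpotent.
- by move=> /nilpotent_right_nilpotent.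
- by move=> /strongly_nilpotent_nilpotent/nilpotent_right_nilpotent.
Qed.
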